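(* Let $Z$ be a compact metrizable space admitting a minimal action of an arc-wise connected topological group $G_a$. Then for every nondegenerate product-minimal space $Y$, the space $Y\times Z$ is also product-minimal; and for every nondegenerate homeo-product-minimal space $Y$, the space $Y\times Z$ is also homeo-product-minimal.
   Context: A dynamical system $(X,T)$ ($X$ metrizable, $T\colon X\to X$ continuous) is minimal if there is no proper nonempty closed $M\subsetneq X$ with $T(M)\subseteq M$. A compact metrizable space $Y$ is product-minimal if for every minimal system $(X,T)$ with $X$ metrizable, not necessarily compact, there is a continuous map $S\colon Y\to Y$ such that $(X\times Y,T\times S)$ is minimal; it is homeo-product-minimal if such $S$ can always be chosen to be a homeomorphism. A space is nondegenerate if it has more than one point. Actions are continuous; an action is minimal if every orbit is dense. *)

(* Defs.v *)
From HB Require Import structures.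
From mathcomp Require Import all_boot all_order all_algebra.
From mathcomp Require Import all_classical all_reals topology.

Set Implicit Arguments.
Unset Strict Implicit.
Unset Printing Implicit Defensive.

Import Order.TTheory GRing.Theory Num.Theory.
Import numFieldTopology.Exports.

Local Open Scope classical_set_scope.
Local Open Scope ring_scope.

Definition homeomorphism (X Y : topologicalType) (f : X -> Y) : Prop :=
  continuous f /\
  exists g : Y -> X, [/\ continuous g, cancel f g & cancel g f].

Definition metrizable (R : realType) (X : topologicalType) : Prop :=
  exists (M : metricType R) (f : X -> M), homeomorphism f.

Definition nondegenerate_space (X : Type) : Prop := exists x y : X, x <> y.

(* `T (M) `<=` M`, not equality, as `T` need not be invertible; `X` need not
   be compact. *)
Definition minimal_system (X : topologicalType) (T : X -> X) : Prop :=
  continuous T /\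
  ~ exists M : set X,
      [/\ closed M, M !=set0, M `<` [set: X] & T @` M `<=` M].

Definition product_map (X Y : Type) (T : X -> X) (S : Y -> Y) : X * Y -> X * Y :=
  fun p => (T p.1, S p.2).

Definition product_minimal (R : realType) (Y : topologicalType) : Prop :=
  [/\ compact [set: Y], metrizable R Y &
    forall (X : topologicalType) (T : X -> X),
      metrizable R X -> minimal_system T ->
      exists2 S : Y -> Y, continuous S & minimal_system (product_map T S)].

Definition homeo_product_minimal (R : realType) (Y : topologicalType) : Prop :=
  [/\ compact [set: Y], metrizable R Y &
    forall (X : topologicalType) (T : X -> X),
      metrizable R X -> minimal_system T ->
      exists2 S : Y -> Y, homeomorphism S & minimal_system (product_map T S)].

HB.mixin Record isTopologicalGroup G & Group G & Topological G := {
  mulg_continuous : continuous (fun p : G * G => (p.1 * p.2)%g) ;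
  invg_continuous : continuous (fun x : G => (x^-1)%g)
}.

#[short(type="topologicalGroupType")]
HB.structure Definition TopologicalGroup :=
  { G of Group G & Topological G & isTopologicalGroup G }.

(* `f` restricted to the unit interval is a homeomorphism onto its image, with
   inverse the restriction of `g`; both are junk elsewhere. A topological group
   that is arcwise connected in this sense is automatically Hausdorff. *)
Definition arcwise_connected (R : realType) (X : topologicalType) : Prop :=
  forall x y : X, x <> y ->
  exists (f : R -> X) (g : X -> R),
    [/\ {within `[0, 1], continuous f},
        {within f @` `[0, 1], continuous g},
        {in `[0, 1], cancel f g},
        f 0 = x & f 1 = y].

Definition continuous_action (G : topologicalGroupType) (Z : topologicalType)
    (act : G -> Z -> Z) : Prop :=
  [/\ forall z, act 1%g z = z,
      forall g h z, act (g * h)%g z = act g (act h z) &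
      continuous (fun p : G * Z => act p.1 p.2)].

Definition minimal_action (G : topologicalGroupType) (Z : topologicalType)
    (act : G -> Z -> Z) : Prop :=
  forall z : Z, dense [set act g z | g in [set: G]].

(* Main.v *)
Require Import Defs.
From HB Require Import structures.
From mathcomp Require Import all_boot all_order all_algebra.
From mathcomp Require Import all_classical all_reals topology.
From mathcomp Require Import normedtype ring lra.

Set Implicit Arguments.
Unset Strict Implicit.
Unset Printing Implicit Defensive.

Import Order.TTheory GRing.Theory Num.Theory.
Import numFieldNormedType.Exports.

Local Open Scope classical_set_scope.
Local Open Scope ring_scope.

(** Fix a minimal system (X, T) and a map S of Y making T x S minimal on X x Y.
    The map sought on Y x Z is a skew product
    (y, z) |-> (S y, phi (y, z)), following Glasner and Weiss: start from the
    coboundaries phi_h (y, z) = h(S y)^-1 h(y) z, where h : Y -> G is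
    continuous, and take a generic uniform limit of them.  Each such skew product
    is conjugate to S x id, hence not minimal unless Z is trivial, but a small
    change of h can make its orbits over one base point as dense as desired.

    As X need not be compact, neither need X x Y x Z, on which minimality has to
    be proved.  What saves the category argument is that a single fibre is
    enough.  Let w_n be the orbit of one point w_0 = (x_0, y_0) of X x Y.  A
    nonempty closed invariant set has a dense projection to X x Y, which
    contains w_0 because Z is compact; so its fibre over w_0 is nonempty, and
    minimality follows once every point over w_0 has a dense orbit
    ([minimal_skew_of_visits]).  As w_n is dense, this amounts to countably many
    conditions, indexed by a and j: for all c and v in Z some n brings w_n
    within 1/(j+1) of w_a and the fibre point c within 1/(j+1) of v.  By
    compactness of Z x Z each condition survives a small uniform change of phi
    ([visits_stable]), and a Baire argument ([uniform_baire]) yields one phi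
    satisfying all of them, provided each can be achieved by a small change of
    h ([visiting_perturbation]).

    For the latter, minimality of the action and compactness give finitely many
    group elements g_0, ..., g_(k-1) one of which moves any c close to any v.  Arcwise
    connectedness provides a path p in G through the g_i.  Now replace h by
    p(theta)^-1 h, where theta : Y -> [0, k] is continuous, nearly
    S-invariant, so that the coboundary hardly moves, and yet takes the value i
    at the point S^n y_0 for some time n = t_i at which w_n is close to w_a.
    Such a theta is a long Birkhoff average of a function that is constantly
    equal to i on the orbit segment starting at time t_i
    ([almost_invariant_steps]).  This requires the points S^n y_0 to be
    distinct, which is where nondegeneracy of Y enters: a minimal S with a
    periodic point would make Y finite, and a finite Y with several points is
    not product-minimal ([product_minimal_aperiodic]).

    The inverse fibre maps h(y)^-1 h(S y) z are carried along through the
    limit, so phi is invertible fibrewise and the skew product is a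
    homeomorphism as soon as S is one. *)

(** * Continuity of composite maps and products *)

Section Continuity.
Context {A B C : topologicalType}.

Lemma continuous_compose (f : A -> B) (g : B -> C) :
  continuous f -> continuous g -> continuous (fun a => g (f a)).
Proof. by move=> cf cg a; apply: (@continuous_comp _ _ _ f g); [exact: cf|exact: cg]. Qed.

Lemma continuous_pairing (f : A -> B) (g : A -> C) :
  continuous f -> continuous g -> continuous (fun a => (f a, g a)).
Proof. by move=> cf cg a; apply: cvg_pair; [exact: cf|exact: cg]. Qed.

Lemma continuous_fst : continuous (fst : A * B -> A).
Proof. by move=> p; exact: cvg_fst. Qed.

Lemma continuous_snd : continuous (snd : A * B -> B).
Proof. by move=> p; exact: cvg_snd. Qed.

End Continuity.

Lemma continuous_binary (A B C D : topologicalType) (h : B * C -> D)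
    (f : A -> B) (g : A -> C) :
  continuous f -> continuous g -> continuous h ->
  continuous (fun a => h (f a, g a)).
Proof.
by move=> cf cg; apply: continuous_compose; exact: continuous_pairing.
Qed.

Lemma prod_fun_continuous (A B C D : topologicalType) (f : A -> C) (g : B -> D) :
  continuous f -> continuous g -> continuous (fun p => (f p.1, g p.2)).
Proof.
move=> cf cg p; apply: cvg_pair => /=.
- by apply: (@continuous_comp _ _ _ fst f); [exact: cvg_fst|exact: cf].
- by apply: (@continuous_comp _ _ _ snd g); [exact: cvg_snd|exact: cg].
Qed.

Lemma homeomorphism_prod_fun (A B C D : topologicalType)
    (f : A -> C) (g : B -> D) :
  homeomorphism f -> homeomorphism g -> homeomorphism (fun p => (f p.1, g p.2)).
Proof.
move=> [cf [f' [cf' fK f'K]]] [cg [g' [cg' gK g'K]]]; split.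
  exact: prod_fun_continuous.
exists (fun p => (f' p.1, g' p.2)); split; first exact: prod_fun_continuous.
- by case=> a b; rewrite /= fK gK.
- by case=> a b; rewrite /= f'K g'K.
Qed.

(** * Minimal systems *)

Section MinimalSystems.

Lemma minimal_eqT (X : topologicalType) (T : X -> X) (M : set X) :
  minimal_system T -> closed M -> M !=set0 -> T @` M `<=` M -> M = setT.
Proof.
move=> [_ noM] cM M0 TM; apply: contrapT => MT; apply: noM.
by exists M; split => //; split=> // sub; apply: MT; rewrite -subTset.
Qed.

(** The closure of a forward orbit is invariant, so by minimality it is the
    whole space. *)
Lemma minimal_visit (X : topologicalType) (T : X -> X) (x u : X) (U : set X) :
  minimal_system T -> nbhs u U -> exists n, U (iter n T x).
Proof.
move=> mT uU; pose O := [set iter n T x | n in [set: nat]].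
suff clO : closure O = setT.
  have : closure O u by rewrite clO.
  by move=> /(_ _ uU) [_ [[n _ <-] Un]]; exists n.
apply: (minimal_eqT mT).
- exact: closed_closure.
- by exists x; apply: subset_closure; exists 0%N.
- move=> _ [v Ov <-] V /(mT.1 v) /Ov [_ [[n _ <-] Vn]].
  by exists (iter n.+1 T x); split=> //; exists n.+1.
Qed.

Lemma minimal_visit_late (X : topologicalType) (T : X -> X) (x u : X)
    (U : set X) (m : nat) :
  minimal_system T -> nbhs u U -> exists n, (m <= n)%N /\ U (iter n T x).
Proof.
move=> mT /(minimal_visit (iter m T x) mT) [n]; rewrite -iterD => Un.
by exists (n + m)%N; rewrite leq_addl.
Qed.

Lemma minimal_conj (A B : topologicalType) (F : A -> A) (F' : B -> B)
    (h : A -> B) :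
  homeomorphism h -> continuous F' -> (forall a, F' (h a) = h (F a)) ->
  minimal_system F -> minimal_system F'.
Proof.
move=> [ch [g [cg hK gK]]] cF' hF mF; split=> // -[M [cM [b Mb] MT FM]].
suff hM : h @^-1` M = setT.
  by case: MT => _; apply=> c _; rewrite -(gK c); have : (h @^-1` M) (g c) by rewrite hM.
apply: (minimal_eqT mF).
- by apply: preimage_closed => // x _; exact: ch.
- by exists (g b); rewrite /preimage/= gK.
- by move=> _ [a Ma <-]; rewrite /preimage/= -hF; apply: FM; exists (h a).
Qed.

Lemma iter_product_map (X Y : Type) (T : X -> X) (S : Y -> Y) n p :
  iter n (product_map T S) p = (iter n T p.1, iter n S p.2).
Proof. by elim: n => [|n /= ->]; [case: p|]. Qed.

Lemma minimal_factor2 (X Y : topologicalType) (T : X -> X) (S : Y -> Y) (x : X) :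
  continuous S -> minimal_system (product_map T S) -> minimal_system S.
Proof.
move=> cS mTS; split=> // -[M [cM [b Mb] MT SM]].
suff E : snd @^-1` M = [set: X * Y].
  by case: MT => _; apply=> c _; have : (snd @^-1` M) (x, c) by rewrite E.
apply: (minimal_eqT mTS).
- by apply: preimage_closed => // p _; exact: cvg_snd.
- by exists (x, b).
- by move=> _ [p Mp <-]; apply: SM; exists p.2.
Qed.

(** In a T1 space a periodic orbit is finite, hence closed, hence everything: the
    system is a cyclic permutation of the points of one orbit. *)
Lemma minimal_periodic (X : topologicalType) (S : X -> X) (x : X) (d : nat) :
  accessible_space X -> minimal_system S -> (0 < d)%N -> iter d S x = x ->
  exists p (f : 'I_p -> X) (g : X -> 'I_p),
    [/\ (0 < p <= d)%N, forall u, iter p S u = u, cancel f g & cancel g f].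
Proof.
move=> T1 mS d0 Sd.
(* The least period enumerates the orbit without repetition. *)
have ex : exists n, (0 < n)%N && `[< iter n S x = x >].
  by exists d; rewrite d0; apply/asboolP.
case: (ex_minnP ex) => p /andP[p0 /asboolP Sp] pmin.
pose f (i : 'I_p) := iter i S x.
have finj : injective f.
  suff H : forall i j : 'I_p, (i < j)%N -> f i <> f j.
    move=> i j fij; apply/val_inj => /=; case: (ltngtP i j) => // lt.
    - by have := H _ _ lt fij.
    - by have := H _ _ lt (esym fij).
  move=> i j ij fij; have jp := ltn_ord j.
  have E : iter (p - j + i) S x = x.
    by rewrite iterD -/(f i) fij /f -iterD subnK // ltnW.
  have := pmin (p - j + i)%N; rewrite addn_gt0 subn_gt0 jp /=.
  move=> /(_ (asboolT E)); rewrite leqNgt; case/negP.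
  by rewrite addnC -ltn_subRL ltn_sub2l // (ltn_trans ij).
have fT : range f = setT.
  apply: (minimal_eqT mS).
  - by apply: (accessible_finite_set_closed.1 T1); apply: finite_image; exact: finite_finset.
  - by exists x; exists (Ordinal p0).
  - move=> _ [_ [i _ <-] <-].
    have := ltn_ord i; rewrite leq_eqVlt => /orP[/eqP ip|ip].
    + by exists (Ordinal p0) => //; rewrite /f/= -iterS ip Sp.
    + by exists (Ordinal ip).
have /choice[g gK] : forall u, exists i, f i = u.
  by move=> u; have : range f u by [rewrite fT]; case=> i _ <-; exists i.
exists p, f, g; split => //.
- by rewrite p0 pmin // d0; apply/asboolP.
- by move=> u; rewrite -(gK u) /f -iterD addnC iterD Sp.
- by move=> i; apply: finj; rewrite gK.
Qed.

End MinimalSystems.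

(** * Products of metrizable spaces *)

Section MetricProduct.
Context {R : realType} {U V : metricType R}.

(** The maximum distance is the one whose balls are the product balls. *)
Let dist (p q : U * V) : R := Num.max (mdist p.1 q.1) (mdist p.2 q.2).

Let dist_ge0 p q : 0 <= dist p q.
Proof. by rewrite /dist le_max mdist_ge0. Qed.

Let dist_positivity p q : dist p q = 0 -> p = q.
Proof.
move=> pq; have : dist p q <= 0 by rewrite pq.
rewrite /dist ge_max => /andP[p1 p2].
case: p q p1 p2 {pq} => [a b] [c d] /= p1 p2; congr pair;
  by apply: mdist_positivity; apply/eqP; rewrite eq_le mdist_ge0 andbT.
Qed.

Let ballEdist p d : ball p d = [set q | dist p q < d].
Proof.
apply/seteqP; split => q; rewrite /dist /= gt_max.
  by case; rewrite !ballEmdist /= => -> ->.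
by move=> /andP[? ?]; split; rewrite ballEmdist.
Qed.

HB.instance Definition _ :=
  PseudoMetric_isMetric.Build R (U * V)%type dist_ge0 dist_positivity ballEdist.

End MetricProduct.

Section Metrizable.
Context {R : realType}.

Lemma metrizable_product (A B : topologicalType) :
  metrizable R A -> metrizable R B -> metrizable R (A * B)%type.
Proof.
move=> [M [f hf]] [N [g hg]]; exists (M * N)%type, (fun p => (f p.1, g p.2)).
exact: homeomorphism_prod_fun.
Qed.

Lemma metrizable_accessible (A : topologicalType) :
  metrizable R A -> accessible_space A.
Proof.
move=> [M [f [cf [g [_ fK _]]]]]; apply: hausdorff_accessible => p q pq.
rewrite -(fK p) -(fK q); congr g; apply: metric_hausdorff => P Q fP fQ.
have [a [Pa Qa]] := pq _ _ (cf p _ fP) (cf q _ fQ).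
by exists (f a).
Qed.

End Metrizable.

(** * Product-minimal spaces have no periodic points *)

Section Aperiodicity.
Context {R : realType}.

(** A minimal map of a p-point space has some periodic point by the pigeonhole
    principle; its orbit is the whole space, so its least period is p. *)
Lemma minimal_finite_period (Y : topologicalType) (S : Y -> Y) p
    (f : 'I_p -> Y) (g : Y -> 'I_p) (y : Y) :
  accessible_space Y -> minimal_system S -> cancel f g -> cancel g f ->
  forall u, iter p S u = u.
Proof.
move=> T1 mS fK gK.
suff [i [d [d0 per]]] : exists i d, (0 < d)%N /\ iter d S (iter i S y) = iter i S y.
  have [q [f' [g' [_ Sq fK' gK']]]] := minimal_periodic T1 mS d0 per.
  suff -> : p = q by [].
  have injp : injective (fun i => g' (f i)) by move=> a b /(can_inj gK')/(can_inj fK).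
  have injq : injective (fun i => g (f' i)) by move=> a b /(can_inj gK)/(can_inj fK').
  apply/eqP; rewrite eqn_leq.
  by have := leq_card _ injp; have := leq_card _ injq; rewrite !card_ord => -> ->.
have /injectivePn[i [j ij Eij]] :
    ~~ injectiveb (fun i : 'I_p.+1 => g (iter i S y)).
  by apply/injectiveP => /leq_card; rewrite !card_ord ltnn.
have {}Eij : iter i S y = iter j S y := can_inj gK Eij.
wlog lt : i j ij Eij / (i < j)%N.
  move=> H; case: (ltngtP i j) => [|ji|/val_inj E].
  - exact: H.
  - by apply: (H j i); rewrite // eq_sym.
  - by rewrite E eqxx in ij.
by exists i, (j - i)%N; rewrite subn_gt0 lt -iterD subnK // ltnW.
Qed.

(** A periodic point makes Y a cycle of p points.  Taking X = Y in the definition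
    of product-minimality gives a minimal S x S' on a space with p^2 points; but
    S and S' both have period p, so an orbit of S x S' has at most p points.
    Hence p^2 <= p, and Y is a single point. *)
Lemma product_minimal_aperiodic (Y : topologicalType) (S : Y -> Y) :
  nondegenerate_space Y -> product_minimal R Y -> minimal_system S ->
  forall y d, (0 < d)%N -> iter d S y <> y.
Proof.
move=> [a [b ab]] [_ mY pY] mS y d d0 Sd.
have T1 := metrizable_accessible mY.
have [p [f [g [/andP[p0 _] Sp fK gK]]]] := minimal_periodic T1 mS d0 Sd.
have [S' cS' mSS'] := pY _ _ mY mS.
have S'p := minimal_finite_period y T1 (minimal_factor2 y cS' mSS') fK gK.
have per : iter p (product_map S S') (y, y) = (y, y).
  by rewrite iter_product_map Sp S'p.
have T2 := metrizable_accessible (metrizable_product mY mY).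
have [r [f2 [g2 [/andP[_ rp] _ _ gK2]]]] := minimal_periodic T2 mSS' p0 per.
have inj : injective (fun ij : 'I_p * 'I_p => g2 (f ij.1, f ij.2)).
  by move=> [i j] [k l] /(can_inj gK2) /= [] /(can_inj fK)-> /(can_inj fK)->.
have := leq_card _ inj; rewrite card_prod !card_ord => ppr.
have p1 : (p <= 1)%N.
  by move: (leq_trans ppr rp); rewrite -[leqRHS]muln1 leq_pmul2l.
by apply: ab; apply: (can_inj gK); apply/val_inj; move: (ltn_ord (g a)) (ltn_ord (g b)) p1;
  case: (p) (g a) (g b) => [|[|]] // [[|?] ?] [[|?] ?].
Qed.

End Aperiodicity.

(** * Uniform limits and a Baire argument for families of functions *)

Section UniformLimits.
Context {R : realType}.

Lemma uniform_approx_continuous (A : topologicalType) (M : pseudoMetricType R)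
    (g : A -> M) :
  (forall e : R, 0 < e ->
     exists2 f : A -> M, continuous f & forall a, ball (f a) e (g a)) ->
  continuous g.
Proof.
move=> H a; apply/cvg_ballP => e e0.
have e20 : 0 < e / 2 by rewrite divr_gt0.
have e40 : 0 < e / 2 / 2 by rewrite divr_gt0.
have [f cf fg] := H _ e40.
near=> b.
have fab : ball (f a) (e / 2 / 2) (f b).
  by near: b; exact: cvg_ball (cf a) _ e40.
have gfb : ball (g a) (e / 2) (f b).
  exact: ball_split (ball_sym (fg a)) fab.
apply: ball_split gfb _; apply: le_ball (fg b).
by rewrite ler_pdivrMr // ler_peMr ?ltW // ltr1n.
Unshelve. all: by end_near. Qed.

(** The Baire category theorem for the uniform closure of D, with each E m open
    and dense there, phrased so that no topology on the function space is
    needed.  Openness is only asked at the approximants produced by density,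
    which is enough for the nested-ball construction; compactness of M replaces
    completeness, a cluster point of the values serving as limit. *)
Lemma uniform_baire (I : Type) (M : pseudoMetricType R)
    (D : set (I -> M)) (E : nat -> set (I -> M)) :
  compact [set: M] -> D !=set0 ->
  (forall m f (e : R), D f -> 0 < e -> exists f' (d : R),
     [/\ D f', 0 < d, forall i, ball (f i) e (f' i) &
       forall g, (forall i, ball (f' i) d (g i)) -> E m g]) ->
  exists g, (forall m, E m g) /\
    forall e : R, 0 < e -> exists2 f, D f & forall i, ball (f i) e (g i).
Proof.
move=> cM [f0 Df0] dense_E.
(* A state is an approximant with the radius of the uniform ball in which
   all later approximants stay. *)
pose St := {x : (I -> M) * R | D x.1 /\ 0 < x.2}.
have stepP : forall mx : nat * St, exists y : St,
    let: (f, r) := sval mx.2 in let: (f', r') := sval y in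
    [/\ r' <= r / 2, r' <= mx.1.+1%:R^-1 / 2, forall i, ball (f i) (r / 2) (f' i) &
       forall g, (forall i, ball (f' i) (r' + r') (g i)) -> E mx.1 g].
  move=> [m [[f r] [/= Df r0]]].
  have r20 : 0 < r / 2 by rewrite divr_gt0.
  have [f' [d [Df' d0 ff' Ef']]] := dense_E m f _ Df r20.
  (* The limit is only known to lie in the ball of twice the radius, hence
     the half of d. *)
  pose r' := Num.min (r / 2) (Num.min (m.+1%:R^-1 / 2) (d / 2)).
  have r'0 : 0 < r' by rewrite !lt_min r20 !divr_gt0 ?invr_gt0 ?ltr0n.
  exists (exist _ (f', r') (conj Df' r'0)) => /=; split => //.
  - by rewrite /r' ge_min lexx.
  - by rewrite /r' !ge_min lexx orbT.
  - move=> g fg; apply: Ef' => i; apply: le_ball (fg i).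
    by rewrite [leRHS]splitr lerD // /r' !ge_min lexx !orbT.
have [F HF] := choice stepP.
pose s0 : St := exist _ (f0, 1) (conj Df0 ltr01).
pose u := fix u n := if n is m.+1 then F (m, u m) else s0.
pose f n := (sval (u n)).1; pose r n := (sval (u n)).2.
have Df n : D (f n) by rewrite /f; case: (u n) => ? [].
have r0 n : 0 < r n by rewrite /r; case: (u n) => ? [].
have step n : [/\ r n.+1 <= r n / 2, r n.+1 <= n.+1%:R^-1 / 2,
    forall i, ball (f n i) (r n / 2) (f n.+1 i) &
    forall g, (forall i, ball (f n.+1 i) (r n.+1 + r n.+1) (g i)) -> E n g].
  have := HF (n, u n); rewrite /f /r /=.
  by case: (sval (u n)) => ? ?; case: (sval (F _)).
have nest k : forall n i, ball (f n i) (r n) (f (n + k)%N i).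
  elim: k => [|k IH] n i; first by rewrite addn0; exact: ballxx.
  have [rn _ fn _] := step n; apply: ball_split (fn i) _.
  by rewrite -addSnnS; apply: le_ball (IH n.+1 i).
have /choice[g gP] : forall i, exists y, forall n, ball (f n i) (r n + r n) y.
  move=> i; have [] := cM ((fun n => f n i) @ \oo).
  - by apply: filterT.
  move=> y [_ yP]; exists y => n.
  have fn : ((fun n => f n i) @ \oo) [set v | ball (f n i) (r n) v].
    by exists n => // k /= /subnKC <-; exact: nest.
  have [v [/= fv yv]] := yP _ _ fn (nbhsx_ballx y _ (r0 n)).
  exact: ball_triangle fv (ball_sym yv).
exists g; split=> [m|e e0].
  by have [_ _ _] := step m; apply => i; exact: gP.
pose n := Num.truncn e^-1.
exists (f n.+1) => // i; apply: le_ball (gP i n.+1).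
have [_ rn _ _] := step n; rewrite -[leRHS]invrK.
apply: (@le_trans _ _ n.+1%:R^-1); first by rewrite [leRHS]splitr lerD.
by rewrite lef_pV2 ?posrE ?invr_gt0 // ltW // truncnS_gt.
Qed.

End UniformLimits.

(** * Paths in an arcwise connected group *)

Section Paths.
Context {R : realType}.

Definition clamp (c : R) (t : R) : R := Num.max 0 (Num.min c t).

Lemma clamp_ge0 c t : 0 <= clamp c t.
Proof. by rewrite le_max lexx. Qed.

Lemma clamp_le c t : 0 <= c -> clamp c t <= c.
Proof. by move=> c0; rewrite ge_max c0 ge_min lexx. Qed.

Lemma clamp_id c t : 0 <= t <= c -> clamp c t = t.
Proof. by move=> /andP[t0 tc]; rewrite /clamp (min_idPr tc) (max_idPr t0). Qed.

Lemma clamp_continuous c : continuous (clamp c).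
Proof.
move=> t; apply: (@continuous_max _ _ (cst 0) (fun x => Num.min c x)).
  exact: cst_continuous.
by apply: (@continuous_min _ _ (cst c) id) => //; exact: cst_continuous.
Qed.

Lemma arcwise_path (X : topologicalType) (x y : X) : arcwise_connected R X ->
  exists g : R -> X, [/\ continuous g, forall t, t <= 0 -> g t = x &
    forall t, 1 <= t -> g t = y].
Proof.
move=> arc; have [->|xy] := pselect (x = y).
  by exists (cst y); split=> //; exact: cst_continuous.
have [f [g [cf _ _ f0 f1]]] := arc x y xy.
exists (f \o clamp 1); split.
- move=> t U Uft.
  have ct : `[0, 1]%classic (clamp 1 t) by rewrite /= in_itv /= clamp_ge0 clamp_le.
  have H : \forall s \near clamp 1 t, `[0, 1]%classic s -> U (f s).
    by have /subspace_continuousP := cf; apply.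
  change (\forall s \near t, U (f (clamp 1 s))).
  have Ht : \forall s \near t, `[0, 1]%classic (clamp 1 s) -> U (f (clamp 1 s)).
    exact: clamp_continuous H.
  apply: filterS Ht => s; apply.
  by rewrite /= in_itv /= clamp_ge0 clamp_le.
- move=> t t0 /=; rewrite /clamp (min_idPr _) ?(max_idPl _) //.
  exact: le_trans t0 ler01.
- by move=> t t1 /=; rewrite /clamp (min_idPl t1) (max_idPr ler01).
Qed.

(** Paths are concatenated by multiplication rather than by gluing: if p is
    constant after time k, its pointwise product with a path leaving 1 at time k
    extends p, and continuity needs no case distinction. *)
Lemma arcwise_group_path (G : topologicalGroupType) (s : nat -> G) (k : nat) :
  arcwise_connected R G ->
  exists2 p : R -> G, continuous p & forall i, (i <= k)%N -> p i%:R = s i.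
Proof.
move=> arc.
suff [p [cp ps _]] : exists p : R -> G, [/\ continuous p,
    forall i, (i <= k)%N -> p i%:R = s i & forall t, k%:R <= t -> p t = s k].
  by exists p.
elim: k => [|k [p [cp ps pk]]].
  exists (cst (s 0%N)); split=> //; first exact: cst_continuous.
  by move=> i; rewrite leqn0 => /eqP ->.
have [g [cg g0 g1]] := arcwise_path 1%g ((s k)^-1 * s k.+1)%g arc.
have pk1 t : k.+1%:R <= t -> (p t * g (t - k%:R) = s k.+1)%g.
  rewrite -natr1 => kt; rewrite g1 ?lerBrDl // pk ?mulVKg //.
  by apply: le_trans kt; rewrite lerDl.
exists (fun t => p t * g (t - k%:R))%g; split=> //.
- apply: continuous_binary (@mulg_continuous G) => //.
  apply: continuous_compose cg => t.
  by apply: cvgB; [exact: cvg_id|exact: cvg_cst].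
- move=> i; rewrite leq_eqVlt => /orP[/eqP->|ik]; first exact: pk1.
  by rewrite g0 ?subr_le0 ?ler_nat // mulg1 ps.
Qed.

End Paths.

(** * Almost invariant functions with prescribed values along an orbit *)

Section AlmostInvariant.
Context {R : realType} {Y : metricType R}.

Lemma mdist_continuous (a : Y) : continuous (mdist a : Y -> R).
Proof.
move=> u; apply/cvgrPdist_lt => e e0; near=> v.
have uv : mdist u v < e.
  by have : ball u e v by [near: v; exact: nbhsx_ballx]; rewrite ballEmdist.
have := metric_triangle a u v; have := metric_triangle a v u.
rewrite (metric_sym v u) ltr_norml; lra.
Unshelve. all: by end_near. Qed.

(** Newton interpolation with distances in place of differences, truncated to
    [[0, c]]. *)
Lemma interpolation (y : nat -> Y) (v : nat -> R) (c : R) (L : nat) :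
  0 <= c -> injective y -> (forall n, 0 <= v n <= c) ->
  exists f : Y -> R, [/\ continuous f, forall u, 0 <= f u <= c &
    forall n, (n < L)%N -> f (y n) = v n].
Proof.
move=> c0 yinj vc.
suff [f cf fy] : exists2 f : Y -> R, continuous f &
    forall n, (n < L)%N -> f (y n) = v n.
  exists (fun u => clamp c (f u)); split.
  - exact: continuous_compose (@clamp_continuous _ c).
  - by move=> u; rewrite clamp_ge0 clamp_le.
  - by move=> n nL; rewrite fy // clamp_id.
elim: L => [|L [f cf fy]]; first by exists (cst 0); first exact: cst_continuous.
pose w u := \prod_(m < L) (mdist (y m) u / mdist (y m) (y L)).
have cw : continuous w.
  rewrite /w; elim: (index_enum _) => [|m s IH].
    by under eq_fun do rewrite big_nil; exact: cst_continuous.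
  under eq_fun do rewrite big_cons.
  move=> u; apply: cvgM; last exact: IH.
  by apply: cvgMl; exact: mdist_continuous.
exists (fun u => f u + (v L - f (y L)) * w u).
  move=> u; apply: cvgD; first exact: cf.
  by apply: cvgMr; exact: cw.
move=> n; rewrite ltnS leq_eqVlt => /orP[/eqP->|nL].
  rewrite /w big1 ?mulr1 ?subrKC // => m _; rewrite divff // gt_eqF //.
  by rewrite mdist_gt0; apply/eqP => /yinj; apply/eqP; rewrite ltn_eqF.
by rewrite /w (bigD1 (Ordinal nL)) //= mdistxx !mul0r mulr0 addr0 fy.
Qed.

(** The Birkhoff average over N steps of a function with values between 0
    and k changes by at most k/N along S.  If the function equals i on the whole orbit
    segment of length N starting at time t_i, the average is exactly i there. *)
Lemma almost_invariant_steps (S : Y -> Y) (y : Y) (t : nat -> nat) (k N : nat) :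
  continuous S -> injective (fun n => iter n S y) -> (0 < N)%N ->
  (forall i, (t i + N <= t i.+1)%N) ->
  exists h : Y -> R, [/\ continuous h, forall u, 0 <= h u <= k%:R,
    forall u, `|h (S u) - h u| <= k%:R / N%:R &
    forall i, (i <= k)%N -> h (iter (t i) S y) = i%:R].
Proof.
move=> cS yinj N0 tN.
have tlt i j : (i < j)%N -> (t i + N <= t j)%N.
  elim: j => // j IH; rewrite ltnS leq_eqVlt => /orP[/eqP->//|/IH ij].
  by apply: leq_trans ij _; apply: leq_trans (tN j); rewrite leq_addr.
(* The segments from t i to t i + N - 1 are disjoint, so at most one i is picked. *)
pose v n : R := if [pick i : 'I_k.+1 | t i <= n < t i + N]%N is Some i
  then i%:R else 0.
have vk n : 0 <= v n <= k%:R.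
  by rewrite /v; case: pickP => [i _|_]; rewrite ?lexx ler0n // ler_nat -ltnS ltn_ord.
have vt i l : (i <= k)%N -> (l < N)%N -> v (l + t i)%N = i%:R.
  move=> ik lN; rewrite /v; case: pickP => [j /andP[jl lj]|].
    case: (ltngtP i j) => [/tlt|/tlt|-> //].
    - by rewrite leqNgt => /negP[]; apply: leq_ltn_trans jl _; rewrite addnC ltn_add2l.
    - by rewrite leqNgt => /negP[]; apply: leq_ltn_trans lj; rewrite leq_addl.
  by move=> /(_ (Ordinal (ik : i < k.+1)%N)); rewrite /= leq_addl addnC ltn_add2l lN.
have [f [cf fk fy]] := interpolation (t k + N) (ler0n R k) yinj vk.
have Ngt0 : 0 < N%:R :> R by rewrite ltr0n.
exists (fun u => N%:R^-1 * \sum_(l < N) f (iter l S u)); split.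
- have cit l : continuous (fun u => iter l S u).
    by elim: l => [|l IH] //=; [move=> u; exact: cvg_id|exact: continuous_compose IH cS].
  move=> u; apply: cvgMr => //; move: u; rewrite -/(continuous _).
  elim: (index_enum _) => [|m s IH].
    by under eq_fun do rewrite big_nil; exact: cst_continuous.
  under eq_fun do rewrite big_cons.
  by move=> u; apply: cvgD; [exact: (continuous_compose (cit m) cf)|exact: IH].
- move=> u; rewrite mulr_ge0 ?invr_ge0 ?ler0n ?sumr_ge0 //=; last first.
    by move=> l _; case/andP: (fk (iter l S u)).
  rewrite ler_pdivrMl //.
  apply: (@le_trans _ _ (\sum_(l < N) k%:R)).
    by apply: ler_sum => l _; case/andP: (fk (iter l S u)).
  by rewrite sumr_const card_ord -[leLHS]mulr_natl.
- move=> u; rewrite -mulrBr.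
  have -> : \sum_(l < N) f (iter l S (S u)) - \sum_(l < N) f (iter l S u) =
      f (iter N S u) - f u.
    elim: (N) => [|n IH]; first by rewrite !big_ord0 !subrr.
    by rewrite !big_ord_recr /= opprD addrACA IH -iterSr /=; ring.
  rewrite normrM normfV [`|N%:R|]gtr0_norm // [leLHS]mulrC ler_pM2r ?invr_gt0 //.
  move/andP: (fk u) => [? ?]; move/andP: (fk (iter N S u)) => [? ?].
  by rewrite ler_norml; lra.
- move=> i ik; under eq_bigr => l _.
    rewrite -iterD fy ?vt //; first over.
    have /orP[/eqP->|/tlt] : (i == k) || (i < k)%N by rewrite -leq_eqVlt.
      by rewrite addnC ltn_add2l.
    move=> itk; apply: leq_trans (leq_addr _ _); apply: leq_trans itk.
    by rewrite addnC ltn_add2l.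
  by rewrite sumr_const card_ord -[i%:R *+ N]mulr_natl mulKf // gt_eqF.
Qed.

End AlmostInvariant.

(** * Skew products and stability of visits *)

Section GroupContinuity.
Context {A Z : topologicalType} {G : topologicalGroupType} {act : G -> Z -> Z}.

Lemma continuous_mulg (f g : A -> G) :
  continuous f -> continuous g -> continuous (fun a => f a * g a)%g.
Proof.
by move=> cf cg; apply: continuous_binary (@mulg_continuous G).
Qed.

Lemma continuous_invg (f : A -> G) :
  continuous f -> continuous (fun a => (f a)^-1)%g.
Proof. by move=> cf; apply: continuous_compose (@invg_continuous G). Qed.

Lemma continuous_act (f : A -> G) (g : A -> Z) :
  continuous_action act -> continuous f -> continuous g ->
  continuous (fun a => act (f a) (g a)).
Proof.
move=> [_ _ ca] cf cg.
exact: (@continuous_binary _ _ _ _ (fun p : G * Z => act p.1 p.2)).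
Qed.

End GroupContinuity.

Lemma compact_forall_near (K : topologicalType) (A : set K) (I : Type)
    (F : set_system I) (FF : Filter F) (P : I -> K -> Prop) :
  compact A -> (forall x, A x -> \forall x' \near x & i \near F, P i x') ->
  \forall i \near F, A `<=` P i.
Proof. by move=> /compact_near_coveringP; apply. Qed.

Section Skew.
Context {R : realType}.

Definition skew (Y Z : Type) (S : Y -> Y) (phi : Y * Z -> Z) (q : Y * Z) : Y * Z :=
  (S q.1, phi q).

Lemma iter_skew_fst (Y Z : Type) (S : Y -> Y) (phi : Y * Z -> Z) n q :
  (iter n (skew S phi) q).1 = iter n S q.1.
Proof. by elim: n => //= n ->. Qed.

(** Uniformity over a compact set of parameters of the continuity at time 0. *)
Lemma compact_uniform_near (K : topologicalType) (M : pseudoMetricType R)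
    (A : set K) (F : R * K -> M) (e : R) :
  compact A -> continuous F -> 0 < e ->
  exists2 d : R, 0 < d & forall u q, `|u| < d -> A q -> ball (F (0, q)) e (F (u, q)).
Proof.
move=> cA cF e0.
have : \forall u \near (0 : R), A `<=` (fun q => ball (F (0, q)) e (F (u, q))).
  apply: (@compact_forall_near _ A _ (nbhs (0 : R)) _ (fun u q => ball (F (0, q)) e (F (u, q))) cA) => q _.
  have : \forall p \near (0 : R, q), ball (F (0, q)) (e / 2) (F p).
    by apply: (cvg_ball (cF (0, q))); rewrite divr_gt0.
  move=> [[U V] [/= U0 Vq] UV]; exists (V, U) => // -[q' u] [/= Vq' Uu].
  apply: (ball_splitr (z := F (0, q))); apply: UV; split => //=.
  exact: nbhs_singleton.
move=> /nbhs_ballP [d /= d0 H]; exists d => // u q ud Aq.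
by apply: H => //; rewrite /ball /= sub0r normrN.
Qed.

(** The position at a fixed time depends continuously on the starting point and,
    uniformly, on the fibre map; compactness of the set of pairs (c, v) then
    gives one d for all of them.  The radius grows from r/2 to r to leave room
    for both movements. *)
Lemma visits_stable (Y : topologicalType) (Z : pseudoMetricType R)
    (S : Y -> Y) (phi : Y * Z -> Z) (y : Y) (P : nat -> Prop) (r : R) :
  compact [set: Z] -> continuous phi -> 0 < r ->
  (forall c v, exists n, P n /\ ball v (r / 2) (iter n (skew S phi) (y, c)).2) ->
  exists2 d : R, 0 < d & forall phi', (forall q, ball (phi q) d (phi' q)) ->
    forall c v, exists n, P n /\ ball v r (iter n (skew S phi') (y, c)).2.
Proof.
move=> cZ cphi r0 vis.
have near_iter n : forall (c : Z) (e : R), 0 < e ->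
    \forall c' \near c & d \near (0 : R)^'+,
    forall phi', (forall q, ball (phi q) d (phi' q)) ->
    ball (iter n (skew S phi) (y, c)).2 e (iter n (skew S phi') (y, c')).2.
  elim: n => [|n IH] c e e0.
    exists (ball c e, setT); first by split; [exact: nbhsx_ballx|exact: filterT].
    by move=> [c' d] [].
  have e20 : 0 < e / 2 by rewrite divr_gt0.
  set q := iter n (skew S phi) (y, c).
  have : \forall p \near (q.1, q.2), ball (phi q) (e / 2) (phi p).
    by rewrite -surjective_pairing; exact: cvg_ball (cphi q) _ e20.
  move=> [[U V] [/= Uq /nbhs_ballP [e' /= e'0 Ve']] UV].
  have [[B D] [/= Bc D0] BD] := IH c e' e'0.
  exists (B, D `&` [set d | d < e / 2]).
    by split=> //=; apply: filterI => //; exact: nbhs_right_lt.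
  move=> [c' d] [/= Bc' [Dd de]] phi' close.
  set q' := iter n (skew S phi') (y, c').
  have qq' : q'.1 = q.1 by rewrite /q /q' !iter_skew_fst.
  have : ball (phi q) (e / 2) (phi q').
    apply: UV; split=> /=; first by rewrite qq'; exact: nbhs_singleton.
    by apply: Ve'; exact: (BD (c', d)).
  by move=> /ball_split; apply; apply: le_ball (close q'); exact: ltW.
(* One quarter of r is spent on moving v, another on moving the orbit. *)
have r40 : 0 < r / 2 / 2 by rewrite !divr_gt0.
have cZZ : compact [set: Z * Z].
  by rewrite -setXTT; exact: compact_setX.
pose Q (d : R) (cv : Z * Z) := forall phi', (forall q, ball (phi q) d (phi' q)) ->
  exists n, P n /\ ball cv.2 r (iter n (skew S phi') (y, cv.1)).2.
have : \forall d \near (0 : R)^'+, [set: Z * Z] `<=` Q d.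
  apply: (@compact_forall_near _ _ _ (at_right (0 : R)) _ Q cZZ) => -[c v] _.
  have [n [Pn vn]] := vis c v.
  have [[B D] [/= Bc D0] BD] := near_iter n c _ r40.
  exists (B `*` ball v (r / 2 / 2), D).
    split=> //=; exists (B, ball v (r / 2 / 2)) => //=.
    by split => //; exact: nbhsx_ballx.
  move=> [[c' v'] d] [/= [Bc' vv'] Dd] phi' close; exists n; split=> //=.
  have := BD (c', d) (conj Bc' Dd) phi' close => /= nn'.
  have := ball_triangle (ball_triangle (ball_sym vv') vn) nn'.
  by apply: le_ball; lra.
move=> H; near (0 : R)^'+ => d.
exists d => [|phi' close c v]; first by near: d; exact: nbhs_right_gt.
have : [set: Z * Z] `<=` Q d by near: d.
by move=> /(_ (c, v) Logic.I); apply.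
Unshelve. all: by end_near. Qed.

End Skew.

(** * Coboundary skew products *)

Section Coboundaries.
Context {R : realType} {Y : topologicalType} {Z : pseudoMetricType R}.
Context {G : topologicalGroupType} (act : G -> Z -> Z).
Hypotheses (cZ : compact [set: Z]) (act_cont : continuous_action act).

(** The fibre map of the skew product obtained from S x id by conjugation with
    (y, z) |-> (y, h(y) z), paired with its fibrewise inverse so that both
    converge together. *)
Definition coboundary (S : Y -> Y) (h : Y -> G) (q : Y * Z) : Z * Z :=
  (act ((h (S q.1))^-1 * h q.1)%g q.2, act ((h q.1)^-1 * h (S q.1))%g q.2).

Lemma coboundary_continuous (S : Y -> Y) (h : Y -> G) :
  continuous S -> continuous h -> continuous (coboundary S h).
Proof.
move=> cS ch.
have c1 : continuous (fun q : Y * Z => h q.1).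
  exact: continuous_compose continuous_fst ch.
have c2 : continuous (fun q : Y * Z => h (S q.1)).
  exact: continuous_compose (continuous_compose continuous_fst cS) ch.
by apply: continuous_pairing; apply: continuous_act act_cont _ continuous_snd;
  apply: continuous_mulg => //; exact: continuous_invg.
Qed.

Lemma coboundaryK (S : Y -> Y) (h : Y -> G) y z :
  (coboundary S h (y, (coboundary S h (y, z)).1)).2 = z /\
  (coboundary S h (y, (coboundary S h (y, z)).2)).1 = z.
Proof.
have [act1 actM _] := act_cont.
by split; rewrite /= -actM mulgA mulgK mulVg act1.
Qed.

(** The cocycle telescopes. *)
Lemma iter_coboundary (S : Y -> Y) (h : Y -> G) (n : nat) (y : Y) (z : Z) :
  iter n (skew S (fun q => (coboundary S h q).1)) (y, z) =
  (iter n S y, act ((h (iter n S y))^-1 * h y)%g z).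
Proof.
have [act1 actM _] := act_cont.
elim: n => [|n /= ->]; first by rewrite /= mulVg act1.
by rewrite /skew /= -actM mulgA mulgK.
Qed.

(** For a single pair (c, v) one group element g suffices, by density of the
    orbit of c, and it keeps working near c, v and a.  Compactness of Z x Z
    leaves finitely many such g and one neighbourhood U of a.  It matters below that g
    depends on (c, v) only, not on y in U. *)
Lemma uniform_transitivity (h : Y -> G) (a : Y) (r : R) :
  minimal_action act -> continuous h -> 0 < r ->
  exists (s : seq G) (U : set Y), nbhs a U /\ forall c v : Z,
    exists2 g, g \in s & forall y, U y -> ball v r (act ((h y)^-1 * g)%g c).
Proof.
move=> act_min ch r0.
(* Finite lists are ordered by inclusion, neighbourhoods by reverse inclusion;
   covering compactness applied to this filter extracts a finite subcover. *)
pose F := filter_from [set sU : seq G * set Y | nbhs a sU.2]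
  (fun sU => [set sV : seq G * set Y | {subset sU.1 <= sV.1} /\ sV.2 `<=` sU.2]).
have FF : Filter F.
  apply: filter_from_filter; first by exists ([::], setT); exact: filterT.
  move=> [s U] [s' U'] /= aU aU'; exists (s ++ s', U `&` U'); first exact: filterI.
  by move=> [s2 U2] /= [sub]; rewrite subsetI => -[UU UU'];
    split; split=> // g gs; apply: sub; rewrite mem_cat gs ?orbT.
pose P (i : seq G * set Y) (cv : Z * Z) := exists2 g, g \in i.1 &
  forall y, i.2 y -> ball cv.2 r (act ((h y)^-1 * g)%g cv.1).
have cZZ : compact [set: Z * Z] by rewrite -setXTT; exact: compact_setX.
have : \forall i \near F, [set: Z * Z] `<=` P i.
  apply: (@compact_forall_near _ _ _ F _ P cZZ) => -[c v] _.
  have r20 : 0 < r / 2 by rewrite divr_gt0.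
  have r40 : 0 < r / 2 / 2 by rewrite divr_gt0.
  have [w [vb [g0 _ g0c]]] : (ball v (r / 2 / 2))° `&` [set act g c | g in [set: G]] !=set0.
    apply: act_min; last exact: open_interior.
    by exists v; exact: nbhsx_ballx.
  have {}vb : ball v (r / 2 / 2) (act g0 c) by rewrite g0c; exact: interior_subset.
  have cpsi : continuous (fun p : Y * Z => act ((h p.1)^-1 * (h a * g0))%g p.2).
    apply: continuous_act act_cont _ continuous_snd; apply: continuous_mulg.
      by apply: continuous_invg; exact: continuous_compose continuous_fst ch.
    exact: cst_continuous.
  have [[U V] [/= Ua Vc] UV] := cvg_ball (cpsi (a, c)) r40.
  exists (V `*` ball v (r / 2),
    [set sU : seq G * set Y | (h a * g0)%g \in sU.1 /\ sU.2 `<=` U]).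
    split=> /=.
      by exists (V, ball v (r / 2)) => //; split=> //; exact: nbhsx_ballx.
    exists ([:: (h a * g0)%g], U) => //= sU [sub subU]; split=> //.
    by apply: sub; rewrite mem_head.
  move=> [[c' v'] [s W]] [/= [Vc' vv'] [gs WU]]; exists (h a * g0)%g => //= y Wy.
  have := UV (y, c') (conj (WU _ Wy) Vc'); rewrite /= mulKg => cc'.
  by apply: ball_splitr vv' _; exact: ball_split vb cc'.
move=> [[s U] /= aU sU]; exists s, U; split=> // c v.
by have /(_ (c, v)) := sU (s, U) (conj (fun g gs => gs) (fun y Uy => Uy)); apply.
Qed.

(** Replacing h by p(h')^-1 h inserts the factor p(h'(S y)) p(h'(y))^-1 into the
    coboundary.  It is 1 when h' is invariant, and uniformly close to 1 when
    h' is nearly invariant, since h' takes its values in a compact interval. *)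
Lemma small_steps (S : Y -> Y) (h : Y -> G) (p : R -> G) (k e : R) :
  compact [set: Y] -> continuous S -> continuous h -> continuous p -> 0 < e ->
  exists2 d : R, 0 < d & forall h' : Y -> R,
    (forall y, 0 <= h' y <= k) -> (forall y, `|h' (S y) - h' y| < d) ->
    forall q, ball (coboundary S h q) e
                   (coboundary S (fun y => (p (h' y))^-1 * h y)%g q).
Proof.
move=> cY cS ch cp e0.
pose F (x : R * (R * (Y * Z))) : Z * Z :=
  let t := x.2.1 in let u := t + x.1 in let q := x.2.2 in
  (act ((h (S q.1))^-1 * (p u * (p t)^-1) * h q.1)%g q.2,
   act ((h q.1)^-1 * (p t * (p u)^-1) * h (S q.1))%g q.2).
have cy : continuous (fun x : R * (R * (Y * Z)) => x.2.2.1).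
  exact: continuous_compose (continuous_compose continuous_snd continuous_snd) continuous_fst.
have cz : continuous (fun x : R * (R * (Y * Z)) => x.2.2.2).
  exact: continuous_compose (continuous_compose continuous_snd continuous_snd) continuous_snd.
have ct : continuous (fun x : R * (R * (Y * Z)) => x.2.1).
  exact: continuous_compose continuous_snd continuous_fst.
have cu : continuous (fun x : R * (R * (Y * Z)) => x.2.1 + x.1).
  by move=> x; apply: cvgD; [exact: ct|exact: continuous_fst].
have c1 := continuous_compose cy ch.
have c2 := continuous_compose (continuous_compose cy cS) ch.
have c3 := continuous_compose ct cp.
have c4 := continuous_compose cu cp.
have cF : continuous F.
  apply: continuous_pairing; apply: continuous_act act_cont _ cz;
  by do !apply: continuous_mulg => //; exact: continuous_invg.
have cA : compact (`[0, k] `*` [set: Y * Z]).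
  apply: compact_setX; first exact: segment_compact.
  by rewrite -setXTT; exact: compact_setX.
have [d d0 H] := compact_uniform_near cA cF e0.
exists d => // h' h'k h'd q.
have := H (h' (S q.1) - h' q.1) (h' q.1, q) (h'd q.1).
rewrite /F /= subrKC addr0 !mulgV !mulg1 /coboundary !invgM !invgK !mulgA.
by apply; split=> //=; rewrite in_itv /= h'k.
Qed.

End Coboundaries.

(** * Small perturbations whose orbits visit every region of a fibre *)

Section Perturbation.
Context {R : realType} {X : pseudoMetricType R} {Y : metricType R}
        {Z : pseudoMetricType R}.
Context {G : topologicalGroupType} {act : G -> Z -> Z}.

(** Over the base orbit, the new fibre point at time n is
    h(S^n y0)^-1 p(theta(S^n y0)) c' where c' = p(theta(y0))^-1 h(y0) c.  At time
    t_i this applies g_i to c'.  Since theta is only nearly invariant along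
    single steps, it can take all the values i at well separated times, each of them
    a time at which the base orbit is near w_a. *)
Lemma visiting_perturbation (T : X -> X) (S : Y -> Y) (x0 : X) (y0 : Y)
    (h : Y -> G) (a : nat) (r e : R) :
  compact [set: Y] -> compact [set: Z] -> arcwise_connected R G ->
  continuous_action act -> minimal_action act ->
  continuous S -> minimal_system (product_map T S) ->
  injective (fun n => iter n S y0) -> continuous h -> 0 < r -> 0 < e ->
  exists h' : Y -> G, [/\ continuous h',
    forall q, ball (coboundary act S h q) e (coboundary act S h' q) &
    forall c v, exists n,
      ball (iter a (product_map T S) (x0, y0)) r (iter n (product_map T S) (x0, y0)) /\
      ball v r (iter n (skew S (fun q => (coboundary act S h' q).1)) (y0, c)).2].
Proof.
move=> cY cZ arcG act_cont act_min cS mTS yinj ch r0 e0.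
pose w n := iter n (product_map T S) (x0, y0).
have [s [B [aB sB]]] := uniform_transitivity cZ act_cont (w a).2 act_min ch r0.
pose k := size s.
have [p cp ps] := arcwise_group_path (nth 1%g s) k arcG.
have [d d0 hd] := small_steps cZ act_cont k%:R cY cS ch cp e0.
(* The averaging length is dictated by the tolerance d on the steps of theta. *)
have [N N0 kNd] : exists2 N, (0 < N)%N & k%:R / N%:R < d.
  exists (Num.truncn (k%:R / d)).+1 => //.
  by rewrite ltr_pdivrMr ?ltr0n // mulrC -ltr_pdivrMr // truncnS_gt.
pose U := ball (w a) r `&` [set u : X * Y | B u.2].
have waU : nbhs (w a) U.
  apply: filterI; first exact: nbhsx_ballx.
  exact: (@continuous_snd X Y (w a) _ aB).
have /choice[next nextP] : forall m, exists n, (m <= n)%N /\ U (w n).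
  by move=> m; exact: minimal_visit_late mTS waU.
(* Return times to U that leave room for an averaging segment in between. *)
pose t := fix t i := if i is j.+1 then next (t j + N)%N else next 0%N.
have tN i : (t i + N <= t i.+1)%N by case: (nextP (t i + N)%N).
have tU i : U (w (t i)).
  by case: i => [|i]; [case: (nextP 0%N)|case: (nextP (t i + N)%N)].
have [theta [ct thetak thetaS thetat]] := almost_invariant_steps k cS yinj N0 tN.
pose h' y := ((p (theta y))^-1 * h y)%g.
exists h'; split.
- apply: continuous_mulg ch; apply: continuous_invg.
  exact: continuous_compose ct cp.
- by apply: hd => // y; exact: le_lt_trans (thetaS y) kNd.
- move=> c v; have [_ actM _] := act_cont.
  have [g gs gB] := sB (act (h' y0) c) v.
  have ik : (index g s < k)%N by rewrite index_mem.
  have [ball_t B_t] := tU (index g s).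
  exists (t (index g s)); split=> //.
  have := gB _ B_t; rewrite /w iter_product_map /= (iter_coboundary act_cont) /=.
  by rewrite /h' thetat ?ps 1?ltnW // nth_index // -actM invgM invgK.
Qed.

End Perturbation.

(** * Minimal skew products *)

Section SkewExtension.
Context {R : realType}.

Lemma limit_cancel (A : topologicalType) (Z : metricType R)
    (phi psi : A * Z -> Z) :
  continuous psi ->
  (forall e : R, 0 < e -> exists phi' psi' : A * Z -> Z,
     [/\ forall q, ball (phi' q) e (phi q), forall q, ball (psi' q) e (psi q) &
       forall a z, psi' (a, phi' (a, z)) = z]) ->
  forall a z, psi (a, phi (a, z)) = z.
Proof.
move=> cpsi approx a z; symmetry; apply: mdist_positivity; apply/eqP.
rewrite eq_le mdist_ge0 andbT; apply/ler_addgt0Pr => e e0; rewrite add0r.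
suff : ball z e (psi (a, phi (a, z))) by rewrite ballEmdist => /ltW.
have e20 : 0 < e / 2 by rewrite divr_gt0.
have [[U V] [/= Ua /nbhs_ballP[d /= d0 dV]] UV] := cvg_ball (cpsi (a, phi (a, z))) e20.
have m0 : 0 < Num.min (e / 2) d by rewrite lt_min e20.
have [phi' [psi' [Hphi Hpsi can]]] := approx _ m0.
have b1 : ball (psi (a, phi (a, z))) (e / 2) (psi (a, phi' (a, z))).
  apply: (UV (a, _)); split=> /=; first exact: nbhs_singleton.
  apply: dV; apply: ball_sym; apply: le_ball (Hphi _).
  by rewrite ge_min lexx orbT.
have b2 : ball z (e / 2) (psi (a, phi' (a, z))).
  rewrite -{1}(can a z); apply: le_ball (Hpsi _).
  by rewrite ge_min lexx.
exact: ball_splitl b2 b1.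
Qed.

(** A closed invariant set meets the fibre over (x0, y0): otherwise, Z being
    compact, it would miss all fibres over a neighbourhood of (x0, y0), which
    the base orbit of any of its points enters.  From such a point the visits
    lead close to every point of the product. *)
Lemma minimal_skew_of_visits (X : pseudoMetricType R) (Y Z : pseudoMetricType R)
    (T : X -> X) (S : Y -> Y) (phi : Y * Z -> Z) (x0 : X) (y0 : Y) :
  compact [set: Z] -> continuous T -> continuous S -> continuous phi ->
  minimal_system (product_map T S) ->
  (forall a j c v, exists n,
      ball (iter a (product_map T S) (x0, y0)) (j.+1%:R^-1 : R)
           (iter n (product_map T S) (x0, y0)) /\
      ball v (j.+1%:R^-1 : R) (iter n (skew S phi) (y0, c)).2) ->
  minimal_system (product_map T (skew S phi)).
Proof.
move=> cZ cT cS cphi mTS vis; split.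
  apply: prod_fun_continuous => //; apply: continuous_pairing cphi.
  exact: continuous_compose continuous_fst cS.
move=> [M [cM [[x [y z]] Mxyz] [_ MT] FM]].
have MF n p : M p -> M (iter n (product_map T (skew S phi)) p).
  by move=> Mp; elim: n => //= n Mn; apply: FM; exists (iter n (product_map T (skew S phi)) p).
have [c Mc] : exists c, M (x0, (y0, c)).
  apply: contrapT => noc.
  have : \forall w \near (x0, y0), [set: Z] `<=` (fun c => ~ M (w.1, (w.2, c))).
    apply: (@compact_forall_near _ _ _ (nbhs (x0, y0)) _ (fun w c => ~ M (w.1, (w.2, c))) cZ) => c _.
    have oM : nbhs (x0, (y0, c)) (~` M).
      by apply: open_nbhs_nbhs; split; [exact: closed_openC|move=> Mc; apply: noc; exists c].
    have [[U V] [/= Ux [[V1 V2] [/= V1y V2c] V12]] UV] := oM.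
    exists (V2, U `*` V1); first by split=> //; exists (U, V1).
    by move=> [c' [x' y']] [/= ? [? ?]]; apply: UV; split=> //; apply: V12.
  move=> /(minimal_visit (x, y) mTS) [n]; rewrite iter_product_map.
  move=> /(_ (iter n (skew S phi) (y, z)).2 Logic.I); apply.
  have := MF n _ Mxyz; rewrite iter_product_map /=.
  by rewrite [X in M (_, X)]surjective_pairing iter_skew_fst.
apply: MT => -[x1 [y1 v]] _; apply: cM => U /nbhs_ballP [e /= e0 eU].
have e20 : 0 < e / 2 by rewrite divr_gt0.
have [a wa] := minimal_visit (x0, y0) mTS (nbhsx_ballx (x1, y1) _ e20).
pose j := Num.truncn (e / 2)^-1.
have je : j.+1%:R^-1 <= e / 2.
  by rewrite -[leRHS]invrK lef_pV2 ?posrE ?invr_gt0 // ltW // truncnS_gt.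
have [n [wn vn]] := vis a j c v.
exists (iter n (product_map T (skew S phi)) (x0, (y0, c))); split; first exact: MF.
have [xn yn] : ball (x1, y1) e (iter n (product_map T S) (x0, y0)).
  by apply: ball_split wa _; apply: le_ball wn.
apply: eU; move: xn yn; rewrite !iter_product_map /= => xn yn.
split=> //=; split; first by rewrite iter_skew_fst.
by apply: le_ball vn; apply: le_trans je _; rewrite ler_pdivrMr // ler_peMr ?ltW // ltr1n.
Qed.

(** The Baire argument, applied to coboundaries with values in Z x Z (fibre maps
    together with their inverses) and to the countably many visiting
    conditions. *)
Lemma minimal_skew_extension (X : pseudoMetricType R) (Y Z : metricType R)
    (G : topologicalGroupType) (act : G -> Z -> Z)
    (T : X -> X) (S : Y -> Y) (x0 : X) (y0 : Y) :
  compact [set: Y] -> compact [set: Z] -> arcwise_connected R G ->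
  continuous_action act -> minimal_action act ->
  continuous T -> continuous S -> minimal_system (product_map T S) ->
  injective (fun n => iter n S y0) ->
  exists phi psi : Y * Z -> Z,
    [/\ continuous phi, continuous psi,
      forall y z, psi (y, phi (y, z)) = z, forall y z, phi (y, psi (y, z)) = z &
      minimal_system (product_map T (skew S phi))].
Proof.
move=> cY cZ arcG act_cont act_min cT cS mTS yinj.
pose w n := iter n (product_map T S) (x0, y0).
pose visits (phi : Y * Z -> Z) (a j : nat) := forall c v : Z, exists n,
  ball (w a) (j.+1%:R^-1 : R) (w n) /\
  ball v (j.+1%:R^-1 : R) (iter n (skew S phi) (y0, c)).2.
pose D := [set coboundary act S h | h in [set h : Y -> G | continuous h]].
pose E m := [set f : Y * Z -> Z * Z |
  if @unpickle (nat * nat)%type m is Some (a, j) then visits (fst \o f) a j else True].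
have cDf f : D f -> continuous f.
  by move=> [h ch <-]; exact: coboundary_continuous.
have [g [gE gD]] : exists g, (forall m, E m g) /\
    forall e : R, 0 < e -> exists2 f, D f & forall i, ball (f i) e (g i).
  apply: uniform_baire.
  - by rewrite -setXTT; exact: compact_setX.
  - exists (coboundary act S (cst 1%g)), (cst 1%g) => //; exact: cst_continuous.
  - move=> m f e Df e0; rewrite /E /=.
    case: (unpickle m) => [[a j]|]; last first.
      by exists f, 1; split=> // i; exact: ballxx.
    have [h ch <-] := Df.
    have r0 : 0 < j.+1%:R^-1 :> R by rewrite invr_gt0 ltr0n.
    have r20 : 0 < j.+1%:R^-1 / 2 :> R by rewrite divr_gt0.
    have [h' [ch' hh' vis]] := visiting_perturbation x0 a cY cZ arcG act_cont
      act_min cS mTS yinj ch r20 e0.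
    have cphi : continuous (fun q => (coboundary act S h' q).1).
      exact: continuous_compose (coboundary_continuous act_cont cS ch') continuous_fst.
    have [|d d0 stable] := @visits_stable R Y Z S _ y0
      (fun n => ball (w a) (j.+1%:R^-1 : R) (w n)) _ cZ cphi r0.
      move=> c v; have [n [wn vn]] := vis c v; exists n; split=> //.
      by apply: le_ball wn; rewrite ler_pdivrMr // ler_peMr ?ltW // ltr1n.
    exists (coboundary act S h'), d; split=> //; first by exists h'.
    by move=> g gd c v; apply: stable => q; case: (gd q).
have cg : continuous g.
  apply: uniform_approx_continuous => e /gD [f Df fg]; exists f => //; exact: cDf.
have cphi : continuous (fst \o g) := continuous_compose cg continuous_fst.
have cpsi : continuous (snd \o g) := continuous_compose cg continuous_snd.
exists (fst \o g), (snd \o g); split=> //.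
- apply: limit_cancel => // e /gD [_ [h _ <-] hg].
  exists (fst \o coboundary act S h), (snd \o coboundary act S h); split.
  + by move=> q; case: (hg q).
  + by move=> q; case: (hg q).
  + by move=> y z; case: (coboundaryK act_cont S h y z).
- apply: limit_cancel => // e /gD [_ [h _ <-] hg].
  exists (snd \o coboundary act S h), (fst \o coboundary act S h); split.
  + by move=> q; case: (hg q).
  + by move=> q; case: (hg q).
  + by move=> y z; case: (coboundaryK act_cont S h y z).
- apply: (minimal_skew_of_visits (x0 := x0) (y0 := y0)) => // a j.
  by have := gE (pickle (a, j)); rewrite /E /= pickleK.
Qed.

End SkewExtension.

(** * From metric to metrizable spaces *)

Section Transfer.
Context {R : realType}.

Lemma compact_homeomorphism (A B : topologicalType) (f : A -> B) :
  homeomorphism f -> compact [set: A] -> compact [set: B].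
Proof.
move=> [cf [g [_ _ gK]]] cA.
have -> : [set: B] = f @` [set: A].
  by apply/seteqP; split=> b // _; exists (g b).
by apply: continuous_compact cA; exact: continuous_subspaceT.
Qed.

Lemma skew_homeomorphism (Y Z : topologicalType) (S : Y -> Y)
    (phi psi : Y * Z -> Z) :
  homeomorphism S -> continuous phi -> continuous psi ->
  (forall y z, psi (y, phi (y, z)) = z) -> (forall y z, phi (y, psi (y, z)) = z) ->
  homeomorphism (skew S phi).
Proof.
move=> [cS [S' [cS' SK S'K]]] cphi cpsi phiK psiK; split.
  by apply: continuous_pairing cphi; exact: continuous_compose continuous_fst cS.
have c1 := continuous_compose (@continuous_fst Y Z) cS'.
exists (fun q => (S' q.1, psi (S' q.1, q.2))); split.
- apply: (continuous_pairing c1); apply: continuous_compose cpsi.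
  by apply: continuous_pairing; [exact: c1|exact: continuous_snd].
- by case=> y z; rewrite /skew /= SK phiK.
- by case=> y z; rewrite /skew /= S'K psiK.
Qed.

(** All systems are transported along homeomorphisms to metric spaces, where
    [minimal_skew_extension] applies, and the result is transported back. *)
Lemma product_minimal_skew (Y Z : topologicalType) (G : topologicalGroupType)
    (act : G -> Z -> Z) :
  compact [set: Z] -> metrizable R Z -> arcwise_connected R G ->
  continuous_action act -> minimal_action act ->
  nondegenerate_space Y -> product_minimal R Y ->
  forall (X : topologicalType) (T : X -> X) (S : Y -> Y),
  metrizable R X -> minimal_system T -> continuous S ->
  minimal_system (product_map T S) ->
  exists phi psi : Y * Z -> Z,
    [/\ continuous phi, continuous psi,
      forall y z, psi (y, phi (y, z)) = z, forall y z, phi (y, psi (y, z)) = z &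
      minimal_system (product_map T (skew S phi))].
Proof.
move=> cZ [MZ [eZ hZ]] arcG [act1 actM act_cont] act_min ndY pY X T S.
move=> [MX [eX hX]] [cT _] cS mTS.
(* Over an empty X minimality is vacuous and the second projection will do. *)
have [[x0 _]|X0] := pselect (exists x : X, True); last first.
  exists snd, snd; split=> //; try exact: continuous_snd.
  split=> [|[M [_ [[x _] _] _ _]]]; last by apply: X0; exists x.
  apply: prod_fun_continuous => //; apply: continuous_pairing continuous_snd.
  exact: continuous_compose continuous_fst cS.
have [cY [MY [eY hY]] _] := pY; have [y0 [_ _]] := ndY.
have [ceX [gX [cgX eXK gXK]]] := hX.
have [ceY [gY [cgY eYK gYK]]] := hY.
have [ceZ [gZ [cgZ eZK gZK]]] := hZ.
pose T' x := eX (T (gX x)); pose S' y := eY (S (gY y)).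
pose act' g z := eZ (act g (gZ z)).
have cT' : continuous T' := continuous_compose (continuous_compose cgX cT) ceX.
have cS' : continuous S' := continuous_compose (continuous_compose cgY cS) ceY.
have act'_cont : continuous_action act'.
  split=> [z|g h z|]; rewrite /act'; first by rewrite act1 gZK.
    by rewrite eZK actM.
  apply: (@continuous_compose _ _ _ (fun p : G * MZ => act p.1 (gZ p.2))) ceZ.
  by apply: continuous_act => //; [exact: continuous_fst|
    exact: continuous_compose continuous_snd cgZ].
have act'_min : minimal_action act'.
  move=> z O [o Oo] oO.
  have [w [Ow [g _ gw]]] : (eZ @^-1` O) `&` [set act g (gZ z) | g in [set: G]] !=set0.
    apply: act_min; first by exists (gZ o); rewrite /preimage /= gZK.
    by apply: open_comp => // ? _; exact: ceZ.
  by exists (eZ w); split=> //; exists g => //; rewrite /act' gw.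
have mTS' : minimal_system (product_map T' S').
  apply: (minimal_conj (homeomorphism_prod_fun hX hY)) mTS.
    exact: prod_fun_continuous.
  by case=> x y; rewrite /product_map /T' /S' /= eXK eYK.
have S'n n : iter n S' (eY y0) = eY (iter n S y0).
  by elim: n => //= n ->; rewrite /S' eYK.
have inj : injective (fun n => iter n S' (eY y0)).
  move=> i j; rewrite !S'n => /(can_inj eYK) Sij.
  have aper := product_minimal_aperiodic ndY pY (minimal_factor2 x0 cS mTS).
  case: (ltngtP i j) => // lt; exfalso.
    apply: (aper (iter i S y0) (j - i)%N); first by rewrite subn_gt0.
    by rewrite -iterD subnK // ltnW.
  apply: (aper (iter j S y0) (i - j)%N); first by rewrite subn_gt0.
  by rewrite -iterD subnK // ltnW.
have [phi [psi [cphi cpsi phiK psiK mphi]]] := minimal_skew_extension (eX x0)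
  (compact_homeomorphism hY cY) (compact_homeomorphism hZ cZ) arcG
  act'_cont act'_min cT' cS' mTS' inj.
have conj_cont (f : MY * MZ -> MZ) : continuous f ->
    continuous (fun q : Y * Z => gZ (f (eY q.1, eZ q.2))).
  move=> cf; apply: continuous_compose cgZ.
  exact: (continuous_compose (prod_fun_continuous ceY ceZ)).
exists (fun q => gZ (phi (eY q.1, eZ q.2))), (fun q => gZ (psi (eY q.1, eZ q.2))).
split.
- exact: conj_cont.
- exact: conj_cont.
- by move=> y z; rewrite /= gZK phiK eZK.
- by move=> y z; rewrite /= gZK psiK eZK.
have hgX : homeomorphism gX by split=> //; exists eX.
have hgY : homeomorphism gY by split=> //; exists eY.
have hgZ : homeomorphism gZ by split=> //; exists eZ.
apply: (minimal_conj (homeomorphism_prod_fun hgX (homeomorphism_prod_fun hgY hgZ))) mphi.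
  apply: prod_fun_continuous => //; apply: continuous_pairing; last exact: conj_cont.
  exact: continuous_compose continuous_fst cS.
by case=> x [y z]; rewrite /product_map /skew /T' /S' /= eXK eYK gYK gZK.
Qed.

End Transfer.

Theorem theorem21 (R : realType) (Z : topologicalType)
    (compactZ : compact [set: Z]) (metrizableZ : metrizable R Z)
    (G : topologicalGroupType) (arcG : arcwise_connected R G)
    (act : G -> Z -> Z)
    (act_cont : continuous_action act) (act_min : minimal_action act) :
  (forall Y : topologicalType, nondegenerate_space Y ->
     product_minimal R Y -> product_minimal R (Y * Z)%type) /\
  (forall Y : topologicalType, nondegenerate_space Y ->
     homeo_product_minimal R Y -> homeo_product_minimal R (Y * Z)%type).
Proof.
split=> Y ndY pY.
- have [cY mY extY] := pY; split.
  + by rewrite -setXTT; exact: compact_setX.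
  + exact: metrizable_product.
  + move=> X T mX mT; have [S cS mTS] := extY X T mX mT.
    have [phi [_ [cphi _ _ _ mphi]]] := product_minimal_skew compactZ metrizableZ
      arcG act_cont act_min ndY pY mX mT cS mTS.
    exists (skew S phi) => //; apply: continuous_pairing cphi.
    exact: continuous_compose continuous_fst cS.
- have [cY mY extY] := pY.
  have pY' : product_minimal R Y.
    split=> // X T mX mT; have [S [cS _] mTS] := extY X T mX mT.
    by exists S.
  split.
  + by rewrite -setXTT; exact: compact_setX.
  + exact: metrizable_product.
  + move=> X T mX mT; have [S hS mTS] := extY X T mX mT.
    have [phi [psi [cphi cpsi phiK psiK mphi]]] := product_minimal_skew compactZ
      metrizableZ arcG act_cont act_min ndY pY' mX mT hS.1 mTS.
    by exists (skew S phi) => //; exact: skew_homeomorphism hS cphi cpsi phiK psiK.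
Qed.
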